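(* Let $N\ge 1$ be an integer, $h=1/N$, let $\beta_x,\beta_y\in D_{0,h}$ be (bounded) coefficient functions and $\epsilon>0$ a constant, and let $$b(u,v)=(\beta_x\nabla_{x+}u+\beta_y\nabla_{y+}u,\,v)_h+\epsilon\,(u,v)_{\nabla,h},\qquad u,v\in D_{0,h}.$$ Then there exists $\mu>0$ such that $$b(u,v)\le\mu\,\|u\|_{\nabla,h}\,\|v\|_{\nabla,h}\qquad\text{for all }u,v\in D_{0,h}.$$
   Context: Let $N\ge1$ be an integer and $h=1/N$. The grid is $\Omega_h=\{(ih,jh):0\le i,j\le N\}\subset[0,1]^2$. $D_h$ is the real vector space of functions $u:\Omega_h\to\mathbb{R}$, with the notation $u_{i,j}=u(ih,jh)$, and $D_{0,h}\subset D_h$ is the subspace of functions vanishing at all boundary grid points (those with $i\in\{0,N\}$ or $j\in\{0,N\}$). Products such as $\beta_x\nabla_{x+}u$ are pointwise. The discrete inner product is $(u,v)_h=h^2\sum_{p\in\Omega_h}u(p)v(p)$. The forward differences are $\nabla_{x+}u_{i,j}=(u_{i+1,j}-u_{i,j})/h$ and $\nabla_{y+}u_{i,j}=(u_{i,j+1}-u_{i,j})/h$. For $u\in D_{0,h}$, $u$ is extended by zero outside the grid, so that these differences are defined on all of $\Omega_h$. For $u,v\in D_{0,h}$, $(u,v)_{\nabla,h}=(\nabla_{x+}u,\nabla_{x+}v)_h+(\nabla_{y+}u,\nabla_{y+}v)_h$ and $\|u\|_{\nabla,h}^2=(u,u)_{\nabla,h}$. *)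

(* Defs.v *)
(* The real numbers are an arbitrary R : realType. *)
From mathcomp Require Import all_boot all_order all_algebra.
From mathcomp Require Import reals.

Set Implicit Arguments.
Unset Strict Implicit.
Unset Printing Implicit Defensive.

Import Order.TTheory GRing.Theory Num.Theory.
Local Open Scope ring_scope.

(* The index pair (i, j), 0 <= i, j <= N, stands for the grid point (ih, jh);
   for N >= 1 this is a bijection with Omega_h. *)
Definition grid (N : nat) := ('I_N.+1 * 'I_N.+1)%type.

Definition mesh (R : realType) (N : nat) : R := N%:R^-1.

Definition on_boundary (N : nat) (p : grid N) : bool :=
  [|| p.1 == 0%N :> nat, p.1 == N :> nat, p.2 == 0%N :> nat | p.2 == N :> nat].

(* Addition and multiplication in this type are the pointwise ones. *)
Definition gridfun (R : realType) (N : nat) := {ffun grid N -> R}.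

Definition gridfun0 (R : realType) (N : nat) : {pred gridfun R N} :=
  [pred u : gridfun R N | [forall p, on_boundary p ==> (u p == 0)]].

Arguments gridfun0 : clear implicits.

Section Operators.
Variables (R : realType) (N : nat).
Local Notation h := (mesh R N).
Local Notation D := {ffun grid N -> R}.
Implicit Types u v : D.

(* Extension by zero; the differences below only ever leave the grid at
   index N.+1, so natural indices suffice. *)
Definition ext0 u (i j : nat) : R :=
  if (i <= N)%N && (j <= N)%N then u (inord i, inord j) else 0.

Definition fdiffx u : D :=
  [ffun p : grid N => (ext0 u p.1.+1 p.2 - ext0 u p.1 p.2) / h].

Definition fdiffy u : D :=
  [ffun p : grid N => (ext0 u p.1 p.2.+1 - ext0 u p.1 p.2) / h].

Definition dot_h u v : R := h ^+ 2 * \sum_(p : grid N) u p * v p.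

Definition dot_grad u v : R :=
  dot_h (fdiffx u) (fdiffx v) + dot_h (fdiffy u) (fdiffy v).

Definition norm_grad u : R := Num.sqrt (dot_grad u u).

Definition bform (betax betay : D) (epsilon : R) u v : R :=
  dot_h (betax * fdiffx u + betay * fdiffy u) v + epsilon * dot_grad u v.

End Operators.

(* Main.v *)
(* The constant mu may depend on h, so pointwise bounds suffice.  A single term
   of the sum defining the gradient norm gives |grad u| <= N * norm_grad u at
   every grid point, and summing differences along a grid line from the boundary,
   where v = 0, gives |v| <= N * norm_grad v. *)
Require Import Defs.
From mathcomp Require Import all_boot all_order all_algebra.
From mathcomp Require Import reals.
From mathcomp Require Import ring.
Import Order.TTheory GRing.Theory Num.Theory.
Local Open Scope ring_scope.

Section PointwiseBounds.
Variables (R : realType) (N : nat).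
Hypothesis N_gt0 : (0 < N)%N.
Local Notation h := (mesh R N).
Implicit Types u v f g : gridfun R N.

Lemma mesh_gt0 : 0 < h.
Proof. by rewrite invr_gt0 ltr0n. Qed.

Lemma dot_h_ge0 f : 0 <= dot_h f f.
Proof.
apply: mulr_ge0; first exact: sqr_ge0.
by apply: sumr_ge0 => p _; rewrite -expr2 sqr_ge0.
Qed.

(** Absorbing the weight [h ^+ 2] into the square makes the left side one summand of a sum of
    squares. *)
Lemma sqr_le_dot_h f p : (h * f p) ^+ 2 <= dot_h f f.
Proof.
rewrite exprMn; apply: ler_wpM2l; first exact: sqr_ge0.
rewrite (bigD1 p) //= -expr2 lerDl.
by apply: sumr_ge0 => q _; rewrite -expr2 sqr_ge0.
Qed.

(** The bound [a] on [f] may vary with the point, so that it can carry the coefficients [betax] and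
    [betay]; for [g] a uniform bound is enough. *)
Lemma dot_h_le f g (a : grid N -> R) (b : R) :
  (forall p, `|f p| <= a p) -> (forall p, `|g p| <= b) ->
  dot_h f g <= h ^+ 2 * (\sum_p a p) * b.
Proof.
move=> fa gb; rewrite -mulrA; apply: ler_wpM2l; first exact: sqr_ge0.
rewrite mulr_suml; apply: ler_sum => p _.
by apply: le_trans (ler_norm _) _; rewrite normrM ler_pM.
Qed.

Lemma norm_grad_ge0 u : 0 <= norm_grad u.
Proof. exact: sqrtr_ge0. Qed.

Lemma mesh_fdiffx_le u p : `|h * fdiffx u p| <= norm_grad u.
Proof.
rewrite -sqrtr_sqr; apply: ler_wsqrtr.
by apply: le_trans (sqr_le_dot_h _ _) _; rewrite lerDl dot_h_ge0.
Qed.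

Lemma mesh_fdiffy_le u p : `|h * fdiffy u p| <= norm_grad u.
Proof.
rewrite -sqrtr_sqr; apply: ler_wsqrtr.
by apply: le_trans (sqr_le_dot_h _ _) _; rewrite lerDr dot_h_ge0.
Qed.

Lemma le_of_mesh (x c : R) : `|h * x| <= c -> `|x| <= N%:R * c.
Proof.
by rewrite normrM (gtr0_norm mesh_gt0) mulrC ler_pdivrMr ?ltr0n // mulrC.
Qed.

Lemma fdiffx_le u p : `|fdiffx u p| <= N%:R * norm_grad u.
Proof. exact/le_of_mesh/mesh_fdiffx_le. Qed.

Lemma fdiffy_le u p : `|fdiffy u p| <= N%:R * norm_grad u.
Proof. exact/le_of_mesh/mesh_fdiffy_le. Qed.

(** Induction on [i] from the side [i = 0], where [v] vanishes: each step to the right changes the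
    value by [h * fdiffx v], hence by at most [norm_grad v]. *)
Lemma ext0_le v (i j : nat) : v \in gridfun0 R N -> (i <= N)%N -> (j <= N)%N ->
  `|ext0 v i j| <= i%:R * norm_grad v.
Proof.
move=> /forallP v0 + jN; elim: i => [|i IHi] iN.
  have /implyP/(_ _)/eqP := v0 (inord 0, inord j).
  rewrite /ext0 jN /= /on_boundary /= inordK // => -> //.
  by rewrite normr0 mul0r.
have -> : ext0 v i.+1 j = ext0 v i j + h * fdiffx v (inord i, inord j).
  rewrite ffunE /= !inordK ?ltnS ?(ltnW iN) // mulrC divfK ?subrKC //.
  exact/lt0r_neq0/mesh_gt0.
rewrite -natr1 mulrDl mul1r; apply: le_trans (ler_normD _ _) _.
by rewrite lerD ?mesh_fdiffx_le // IHi // ltnW.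
Qed.

Lemma gridfun0_le v p : v \in gridfun0 R N -> `|v p| <= N%:R * norm_grad v.
Proof.
case: p => i j v0.
have := @ext0_le v i j v0 (ltn_ord i) (ltn_ord j).
rewrite /ext0 -ltnS ltn_ord -ltnS ltn_ord /= !inord_val => /le_trans; apply.
by rewrite ler_wpM2r ?norm_grad_ge0 // ler_nat -ltnS.
Qed.

End PointwiseBounds.

Theorem lemma4 (R : realType) (N : nat) (hN : (1 <= N)%N)
    (betax betay : gridfun R N)
    (hbetax : betax \in gridfun0 R N) (hbetay : betay \in gridfun0 R N)
    (epsilon : R) (heps : 0 < epsilon) :
  exists2 mu : R, 0 < mu &
    forall u v : gridfun R N, u \in gridfun0 R N -> v \in gridfun0 R N ->
      bform betax betay epsilon u v <= mu * norm_grad u * norm_grad v.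
Proof.
set B := \sum_p (`|betax p| + `|betay p|).
(* The number of grid points, kept as a sum of ones to match the sum produced by [dot_h_le]. *)
pose M : R := \sum_(p : grid N) 1.
have B_ge0 : 0 <= B by apply: sumr_ge0 => p _; rewrite addr_ge0.
have M_gt0 : 0 < M.
  by rewrite /M sumr_const ltr0n; apply/card_gt0P; exists (ord0, ord0).
(* [h ^+ 2] comes from the inner product, [N ^+ 2] from the two pointwise bounds; their product is
   in fact 1. *)
pose c : R := mesh R N ^+ 2 * N%:R ^+ 2.
have c_gt0 : 0 < c by rewrite mulr_gt0 // exprn_gt0 ?mesh_gt0 ?ltr0n.
(* [B] pays for the convection term and one [M] for each of the two difference directions. [B] may
   be zero, so positivity comes from the [epsilon] part. *)
exists (c * (B + epsilon * (M + M))).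
  by rewrite mulr_gt0 // ltr_wpDl // mulr_gt0 // addr_gt0.
move=> u v _ v0.
have conv_le : dot_h (betax * fdiffx u + betay * fdiffy u) v
    <= c * B * norm_grad u * norm_grad v.
  pose a p := (`|betax p| + `|betay p|) * (N%:R * norm_grad u).
  have -> : c * B * norm_grad u * norm_grad v =
      mesh R N ^+ 2 * (\sum_p a p) * (N%:R * norm_grad v).
    by rewrite /a -mulr_suml -/B /c; ring.
  apply: dot_h_le => p; last exact: gridfun0_le.
  have -> : (betax * fdiffx u + betay * fdiffy u) p =
      betax p * fdiffx u p + betay p * fdiffy u p by rewrite !ffunE.
  rewrite /a mulrDl; apply: le_trans (ler_normD _ _) _.
  by rewrite !normrM lerD // ler_wpM2l // ?fdiffx_le ?fdiffy_le.
(* One argument for both directions: [d] will be [fdiffx] and then [fdiffy]. *)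
have diff_le (d : gridfun R N -> gridfun R N) :
    (forall w p, `|d w p| <= N%:R * norm_grad w) ->
  dot_h (d u) (d v) <= c * M * norm_grad u * norm_grad v.
  (* The factor 1 lets the constant be pulled out of the sum, leaving [M]. *)
  move=> d_le; pose a (p : grid N) : R := 1 * (N%:R * norm_grad u).
  have -> : c * M * norm_grad u * norm_grad v =
      mesh R N ^+ 2 * (\sum_p a p) * (N%:R * norm_grad v).
    by rewrite /a -mulr_suml -/M /c; ring.
  by apply: dot_h_le => // p; rewrite /a mul1r.
have -> : c * (B + epsilon * (M + M)) * norm_grad u * norm_grad v =
    c * B * norm_grad u * norm_grad v +
    epsilon * (c * M * norm_grad u * norm_grad v + c * M * norm_grad u * norm_grad v).
  by ring.
apply: lerD conv_le _; rewrite ler_wpM2l ?(ltW heps) //.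
by apply: lerD; apply: diff_le => w p; [apply: fdiffx_le|apply: fdiffy_le].
Qed.
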